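(* Let $P$ be a polygon with dissection $\mathcal{D}$ and vertices $v_1,\ldots,v_n$ labelled counterclockwise, and let $v_i,v_j$ be two distinct vertices, with $v_j$ following $v_i$ in counterclockwise order. Then $\sum_{w\in\mathcal{M}_{i,j}}wt_L(w)=\sum_{w\in\mathcal{M}_{i,j}}wt_T(w)$.
   Context: Subgons are the polygons into which the non-crossing diagonals of $\mathcal{D}$ divide $P$; $|\mathcal{P}|$ denotes the number of sides. $\lambda_p=2\cos(\pi/p)$; $U_k$ are the normalized Chebyshev polynomials, $U_{-1}=0$, $U_0=1$, $U_k(x)=xU_{k-1}(x)-U_{k-2}(x)$. $\mathcal{M}_{i,j}$ is the set of matchings between $v_i$ and $v_j$: sequences $w=(\mathcal{P}_{i+1},\ldots,\mathcal{P}_{j-1})$ (indices of vertices read counterclockwise from $v_i$ to $v_j$, mod $n$) with $\mathcal{P}_k$ a subgon incident to $v_k$; if $v_j$ immediately follows $v_i$, $\mathcal{M}_{i,j}=\{\emptyset\}$. Local weight: $wt_L(\emptyset)=1$; if the first $k\ge1$ entries of $w$ equal $\mathcal{P}_{i+1}$ and the next one (if any) differs, $wt_L(w)=U_k(\lambda_{|\mathcal{P}_{i+1}|})\,wt_L(\text{remaining sequence})$. Traditional weight: for each subgon $\mathcal{P}$ let $k_{\mathcal{P}}$ be the number of entries of $w$ equal to $\mathcal{P}$; if some $k_{\mathcal{P}}>|\mathcal{P}|-2$ then $wt_T(w)=0$, otherwise $wt_T(w)=\prod_{\mathcal{P}}U_{k_{\mathcal{P}}}(\lambda_{|\mathcal{P}|})$.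 *)

(* Defs.v *)
From mathcomp Require Import all_boot all_order all_algebra.
From mathcomp Require Import reals trigo.

Set Implicit Arguments.
Unset Strict Implicit.
Unset Printing Implicit Defensive.

Import GRing.Theory.
Local Open Scope ring_scope.

(* The vertices of the polygon P, in counterclockwise order, are the elements
   of 'I_n; the successor of a vertex is given by ordS. *)

Section Dissections.

Variable n : nat.
Implicit Types (a b c d i j : 'I_n) (e f Q : {set 'I_n}).
Implicit Types D : {set {set 'I_n}}.

(* Number of counterclockwise steps from a to b, with value 0 if a = b. *)
Definition ccw a b : nat := ((b + (n - a)) %% n)%N.

Definition side e : bool := [exists a, e == [set a; ordS a]].

Definition diagonal e : bool :=
  [exists a, exists b,
     [&& e == [set a; b], a != b, b != ordS a & a != ordS b]].

Definition crossing e f : bool :=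
  [exists a, exists b, exists c, exists d,
     [&& e == [set a; b], f == [set c; d],
         (0 < ccw a c)%N, (ccw a c < ccw a b)%N & (ccw a b < ccw a d)%N]].

Definition dissection D : bool :=
  [forall e in D, diagonal e] &&
  [forall e in D, forall f in D, ~~ crossing e f].

(* b is the first vertex of Q met when going counterclockwise from a. *)
Definition next_in Q a b : bool :=
  [&& a \in Q, b \in Q, a != b &
      [forall c in Q, ~~ ((0 < ccw a c)%N && (ccw a c < ccw a b)%N)]].

Definition subpolygon_side Q e : bool :=
  [exists a, exists b, next_in Q a b && (e == [set a; b])].

(* A subgon is encoded by its set of vertices Q, so that its number of sides is
   #|Q|: its sides are sides of P or elements of D, and no element of D cuts it.
   As the elements of D cross neither each other nor the sides of P, an element
   of D can only cut Q by joining two non-consecutive vertices of Q. *)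
Definition subgon D Q : bool :=
  [&& (3 <= #|Q|)%N,
      [forall e, subpolygon_side Q e ==> (side e || (e \in D))] &
      [forall e in D, (e \subset Q) ==> subpolygon_side Q e]].

(* The entry of index k (counted from 0) of a matching between i and j is a
   subgon incident to the vertex k + 1 steps after i; when i != j there are
   ccw i j - 1 vertices strictly between i and j. *)
Definition matchings D i j : {set (ccw i j).-1.-tuple {set 'I_n}} :=
  [set w : (ccw i j).-1.-tuple {set 'I_n} |
    [forall k, subgon D (tnth w k) &&
               (iter k.+1 (@ordS n) i \in tnth w k)]].

End Dissections.

Section Weights.

Variables (R : realType) (n : nat).
Implicit Types (D : {set {set 'I_n}}) (Q : {set 'I_n}) (w : seq {set 'I_n}).

Definition lambda (p : nat) : R := 2 * cos (pi / p%:R).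

(* The value 'X of U_1 is 'X * U_0 - U_(-1) with U_(-1) = 0. *)
Fixpoint chebU (k : nat) : {poly R} :=
  match k with
  | 0 => 1
  | k1.+1 => if k1 is k2.+1 then 'X * chebU k1 - chebU k2 else 'X
  end.

(* Local weight of a sequence made of k copies of Q followed by w. *)
Fixpoint wtL_run Q (k : nat) w : R :=
  if w is Q' :: w' then
    if Q' == Q then wtL_run Q k.+1 w'
    else (chebU k).[lambda #|Q|] * wtL_run Q' 1 w'
  else (chebU k).[lambda #|Q|].

Definition wtL w : R := if w is Q :: w' then wtL_run Q 1 w' else 1.

Definition wtT D w : R :=
  if [exists Q, subgon D Q && (#|Q| - 2 < count_mem Q w)%N] then 0
  else \prod_(Q | subgon D Q) (chebU (count_mem Q w)).[lambda #|Q|].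

End Weights.

(* Main.v *)
(* Both sums, as functions of the starting vertex i, satisfy
     T(i-1,j) = (sum of lambda_|Q| over the subgons Q at v_i) T(i,j) - T(i+1,j)
   with the same initial values.

   For local weights this is the Chebyshev recursion applied to the first run,
   since exactly one subgon contains the side v_i v_(i+1).

   For traditional weights, attach to each subgon Q a variable x_Q with
   x_Q^(|Q|-1) = 0; the sum is the image of the product over the vertices v
   strictly between v_i and v_j of the sums of the x_Q, Q at v, under the linear
   map sending a monomial to the product of the U_k(lambda_|Q|). If v_x, v_z are
   consecutive vertices of a subgon, the factors of the vertices strictly between
   them multiply to the monomial in which each subgon Q inside that arc has its
   top exponent |Q|-2. This gives, for a subgon Q at v_i with neighbours u (next)
   and u' (previous) of v_i in Q, that the sum of wt_T over the matchings between
   v_(i-1) and v_j whose first entry is Q is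
     lambda_|Q| T(i,j) - T(u,j) + T(u',j),
   where a term is 0 when its vertex is not strictly between v_i and v_j. Each
   diagonal at v_i occurs once as v_i u and once as v_i u', so summing over Q
   telescopes. *)

Require Import Defs.
From mathcomp Require Import all_boot all_order all_algebra.
From mathcomp Require Import reals trigo.
From mathcomp Require Import zify ring.

Set Implicit Arguments.
Unset Strict Implicit.
Unset Printing Implicit Defensive.

Import Order.TTheory GRing.Theory Num.Theory.

(** * Chebyshev values at [lambda p] *)

Section Chebyshev.

Variable R : realType.
Local Open Scope ring_scope.

Lemma chebU_rec k (x : R) :
  (chebU R k.+2).[x] = x * (chebU R k.+1).[x] - (chebU R k).[x].
Proof. by rewrite -[chebU R k.+2]/('X * chebU R k.+1 - chebU R k) !hornerE. Qed.

(** Dividing by sin t > 0, where t = pi/p, reads off the two values that matter: U_(p-2) is 1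
    because sin (pi - t) = sin t, and U_(p-1) is 0 because sin pi = 0. *)
Lemma chebU_sin k p :
  (chebU R k).[lambda R p] * sin (pi / p%:R) = sin (k.+1%:R * (pi / p%:R)).
Proof.
set t : R := pi / p%:R.
suff [] : (chebU R k).[lambda R p] * sin t = sin (k.+1%:R * t) /\
  (chebU R k.+1).[lambda R p] * sin t = sin (k.+2%:R * t) by [].
elim: k => [|k [IH1 IH2]].
  split; first by rewrite hornerE !mul1r.
  by rewrite hornerE mulr_natl mulr2n sinD /lambda -/t; ring.
split=> //; rewrite chebU_rec mulrBl -mulrA IH1 IH2 /lambda -/t.
have -> : k.+3%:R * t = k.+2%:R * t + t by rewrite -[in LHS]natr1; ring.
have -> : k.+1%:R * t = k.+2%:R * t - t by rewrite -[in RHS]natr1; ring.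
by rewrite sinB sinD; ring.
Qed.

Lemma sin_pi_div_gt0 p : (2 < p)%N -> 0 < sin (pi / p%:R) :> R.
Proof.
move=> p3; have p0 : 0 < p%:R :> R by rewrite ltr0n; lia.
apply: sin_gt0_pi; rewrite divr_gt0 ?pi_gt0 //=.
by rewrite ltr_pdivrMr // ltr_pMr ?pi_gt0 // ltr1n; lia.
Qed.

Lemma chebU_sub2 p : (2 < p)%N -> (chebU R (p - 2)).[lambda R p] = 1.
Proof.
move=> p3; have s0 := sin_pi_div_gt0 p3; apply: (mulIf (lt0r_neq0 s0)).
rewrite mul1r chebU_sin; have -> : (p - 2).+1 = (p - 1)%N by lia.
rewrite natrB; last by lia.
rewrite mulrBl mul1r mulrC divfK ?sinB ?sinpi ?cospi; last first.
  by rewrite pnatr_eq0; lia.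
by ring.
Qed.

Lemma chebU_sub1 p : (2 < p)%N -> (chebU R (p - 1)).[lambda R p] = 0.
Proof.
move=> p3; have s0 := sin_pi_div_gt0 p3; apply: (mulIf (lt0r_neq0 s0)).
rewrite mul0r chebU_sin; have -> : (p - 1).+1 = p by lia.
by rewrite mulrC divfK ?sinpi // pnatr_eq0; lia.
Qed.

End Chebyshev.

(** * Counterclockwise distances as linear arithmetic *)

Section CyclicOrder.

Variable n : nat.
Implicit Types (a b c d v x y z : 'I_n) (Q N : {set 'I_n}).

Lemma ccwP a b :
  (a <= b /\ ccw a b = b - a) \/ (b < a /\ ccw a b = n + b - a).
Proof.
rewrite /ccw; have := ltn_ord a; have := ltn_ord b; case: (leqP a b) => h lb la.
  left; split=> //; have -> : b + (n - a) = b - a + n by lia.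
  by rewrite modnDr modn_small //; lia.
by right; split=> //; rewrite modn_small; lia.
Qed.

Opaque ccw.

Lemma ord_neq a b : a != b -> nat_of_ord a <> b.
Proof. by move=> /eqP h /ord_inj. Qed.

Ltac ccw_val_lia :=
  repeat match goal with
  | H : is_true (~~ (@eq_op _ ?a ?b)) |- _ => move/ord_neq: H => H
  | H : context [ccw _ _] |- _ => revert H
  end;
  repeat match goal with
  | |- context [@ccw n ?a ?b] =>
    move: (ccwP a b) (ltn_ord a) (ltn_ord b);
    generalize (@ccw n a b);
    let k := fresh "k" in let h := fresh "h" in
    let u := fresh "u" in let v := fresh "v" in intros k h u v
  end;
  intros; first [lia | apply: ord_inj; lia | apply/eqP/ord_inj; lia ].

Lemma ccw_lt a b : ccw a b < n.
Proof. ccw_val_lia. Qed.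

Lemma ccwxx a : ccw a a = 0.
Proof. ccw_val_lia. Qed.

Lemma ccw_gt0 a b : (0 < ccw a b) = (a != b).
Proof.
case: eqP => [->|h]; first by rewrite ccwxx.
by move/eqP: h => h /=; ccw_val_lia.
Qed.

Lemma ccw_inj a : injective (ccw a).
Proof. move=> b c h; ccw_val_lia. Qed.

Lemma ccw_ordS a : 1 < n -> ccw a (ordS a) = 1.
Proof.
move=> n1; have := ltn_ord a; rewrite leq_eqVlt => /orP[/eqP an|an].
  have h : nat_of_ord (ordS a) = 0 by rewrite /= an modnn.
  by move: h; ccw_val_lia.
have h : nat_of_ord (ordS a) = a.+1 by rewrite /= modn_small.
by move: h; ccw_val_lia.
Qed.

Lemma ordS_ccw a b : ccw a b = 1 -> b = ordS a.
Proof.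
by move=> h; apply: (@ccw_inj a); rewrite ccw_ordS //; have := ccw_lt a b; lia.
Qed.

Lemma set2_eq (T : finType) (a b c d : T) : [set a; b] = [set c; d] ->
  (a = c /\ b = d) \/ (a = d /\ b = c).
Proof.
move=> e; have : a \in [set c; d] by rewrite -e set21.
have : b \in [set c; d] by rewrite -e set22.
have : c \in [set a; b] by rewrite e set21.
have : d \in [set a; b] by rewrite e set22.
move=> /set2P[]-> /set2P[]-> /set2P[]hb /set2P[]ha; subst; auto.
Qed.

(** Distances add up modulo [n]. Measuring from one base vertex [b] turns statements on cyclic order
    into linear arithmetic, after a case split for each pair. *)
Lemma ccw_base b x y :
  (ccw b x <= ccw b y /\ ccw x y + ccw b x = ccw b y) \/
  (ccw b y < ccw b x /\ ccw x y + ccw b x = n + ccw b y).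
Proof.
have := ltn_ord b; have := ltn_ord x; have := ltn_ord y.
by case: (ccwP b x) => -[? ->]; case: (ccwP b y) => -[? ->];
   case: (ccwP x y) => -[? ->]; lia.
Qed.

Lemma ccw_neq b x y : x != y -> ccw b x <> ccw b y.
Proof. by move=> /eqP h /ccw_inj. Qed.

End CyclicOrder.

Ltac ccw_revert :=
  repeat match goal with H : context [ccw _ _] |- _ => revert H end;
  repeat match goal with H : is_true (2 < ?m) |- _ => is_var m; revert H end.

(* Hypotheses not about ccw are cleared: lia would otherwise compare boolean atoms
   such as [subgon D Q] up to conversion, which is very slow. *)
Ltac ccw_lia :=
  ccw_revert;
  repeat match goal with |- context [ccw ?a ?c] =>
    move: (ccw_lt a c); generalize (ccw a c);
    let k := fresh "k" in let h := fresh "h" in intros k h; revert h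
  end;
  repeat match goal with H : _ |- _ => clear H end;
  intros; lia.

(* Expresses every ccw in terms of the distances from the vertex b. *)
Ltac ccw_lia_from b :=
  have ? := ccwxx b;
  repeat match goal with
  | H : is_true (~~ (@eq_op _ ?a ?c)) |- _ => move/(ccw_neq (b := b)): H => H
  end;
  ccw_revert;
  repeat match goal with
  | |- context [ccw ?a ?c] =>
    tryif constr_eq a b then fail else
    (move: (ccw_base b a c); generalize (ccw a c);
     let k := fresh "k" in let h1 := fresh "h" in let h2 := fresh "h" in
     intros k [[h1 h2]|[h1 h2]]; revert h1 h2)
  end;
  ccw_lia.

(** * Consecutive vertices, gaps and arcs of a vertex set *)

Section Polygons.

Variable n : nat.
Implicit Types (a b c d v x y z : 'I_n) (Q N : {set 'I_n}).

Lemma nextP Q a b : reflect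
  [/\ a \in Q, b \in Q, a != b & forall c, c \in Q -> ~ (0 < ccw a c < ccw a b)]
  (next_in Q a b).
Proof.
apply: (iffP and4P) => -[h1 h2 h3 h4]; split=> //.
  by move=> c /(forall_inP h4) /negP.
by apply/forall_inP => c /h4 /negP.
Qed.

Lemma next_uniq Q a b c : next_in Q a b -> next_in Q a c -> b = c.
Proof.
move=> /nextP[aQ bQ ab hb] /nextP[_ cQ ac hc]; apply: (@ccw_inj _ a).
by have := hb c cQ; have := hc b bQ; rewrite !ccw_gt0 ab ac /=; lia.
Qed.

Lemma prev_uniq Q a b c : next_in Q a c -> next_in Q b c -> a = b.
Proof.
move=> /nextP[aQ cQ ac ha] /nextP[bQ _ bc hb].
apply: (@ccw_inj _ c); have := ha b bQ; have := hb a aQ; ccw_lia_from c.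
Qed.

Lemma next_ex Q a b : a \in Q -> b \in Q -> a != b -> exists c, next_in Q a c.
Proof.
move=> aQ bQ ab; pose P := [pred c | (c \in Q) && (a != c)].
have Pb : P b by rewrite inE bQ.
exists [arg min_(c < b | P c) ccw a c]; apply/nextP.
case: arg_minnP => // c /andP[cQ ac] h; split=> // d dQ /andP[d0 dc].
by have := h d; rewrite inE dQ -ccw_gt0 d0; lia.
Qed.

Lemma prev_ex Q a b : a \in Q -> b \in Q -> a != b -> exists c, next_in Q c a.
Proof.
move=> aQ bQ ab; pose P := [pred c | (c \in Q) && (a != c)].
have Pb : P b by rewrite inE bQ.
exists [arg max_(c > b | P c) ccw a c]; apply/nextP.
case: arg_maxnP => // c /andP[cQ ac] h; split=> //; first by rewrite eq_sym.
move=> d dQ /andP[d0 dc]; have := h d; rewrite inE dQ -ccw_gt0.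
by move: ac d0 dc; ccw_lia_from a.
Qed.

Lemma third_vertex Q a b : 2 < #|Q| -> exists2 c, c \in Q & (c != a) && (c != b).
Proof.
move=> Q3; have [c|h] := pickP [pred c in Q | (c != a) && (c != b)].
  by move=> /andP[cQ h]; exists c.
have /subset_leq_card : Q \subset [set a; b].
  by apply/subsetP => c cQ; move: (h c); rewrite !inE cQ /= -negb_or => /negbFE.
by rewrite cards2; lia.
Qed.

(** [x] is the vertex of [Q] from which [v] is reached in the fewest counterclockwise steps; its
    successor in [Q] cannot come before [v], as it would be nearer. *)
Lemma gap_ex Q v : 2 < #|Q| -> v \notin Q ->
  exists x y, next_in Q x y /\ 0 < ccw x v < ccw x y.
Proof.
move=> Q3 vQ; have [q qQ _] := third_vertex v v Q3.
have := @arg_minnP _ q [pred c in Q] (fun c => ccw c v) qQ.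
case=> x /= xQ hx; have [a aQ /andP[ax _]] := third_vertex x x Q3.
have [y xy] := next_ex xQ aQ ltac:(by rewrite eq_sym).
exists x, y; split=> //; case/nextP: xy => _ yQ nxy h.
have xv : x != v by apply: contraNneq vQ => <-.
have yv : y != v by apply: contraNneq vQ => <-.
by have := hx y yQ; ccw_lia_from x.
Qed.

Definition ccw_arc x y := [set v | ccw x v <= ccw x y].

Lemma in_arc x y v : (v \in ccw_arc x y) = (ccw x v <= ccw x y).
Proof. by rewrite inE. Qed.

Lemma next_arc_card Q x y : next_in Q x y -> 2 < #|Q| ->
  ~ Q \subset ccw_arc x y.
Proof.
move=> /nextP[xQ yQ nxy h] Q3 /subsetP s.
have [c cQ /andP[cx cy]] := third_vertex x y Q3.
have := s c cQ; rewrite in_arc => ?; have := h c cQ; ccw_lia_from x.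
Qed.

(** The equation on distances says that [x], [y], [x'], [y'] come in this order within one turn, so
    the two arcs meet at most in [x] and [y], whereas [Q] has a third vertex. *)
Lemma arc_cap_card Q x y x' y' : 2 < #|Q| ->
  Q \subset ccw_arc x y -> Q \subset ccw_arc x' y' ->
  ccw x y + ccw y x' + ccw x' y' + ccw y' x = n -> False.
Proof.
move=> Q3 /subsetP s /subsetP s' e.
have [c cQ /andP[cx cy]] := third_vertex x y Q3.
have := s c cQ; have := s' c cQ; rewrite !in_arc; ccw_lia_from x.
Qed.

End Polygons.

(** * Subgons of a dissection: mutual position, existence, uniqueness *)

Section Dissections.

Variables (n : nat) (D : {set {set 'I_n}}).
Hypotheses (n_ge3 : 2 < n) (dissD : dissection D).
Implicit Types (a b i j v x y z : 'I_n) (Q N : {set 'I_n}).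

Lemma diag_ccw a b : [set a; b] \in D -> 1 < ccw a b < n.-1.
Proof.
case/andP: dissD => /forall_inP h _ /h.
case/existsP => a' /existsP[b' /and4P[/eqP e]].
wlog [-> ->] : a' b' e / a = a' /\ b = b'.
  move=> W; case: (set2_eq e) => -[ha hb] h1 h2 h3.
    by apply: (W a' b').
  by apply: (W b' a') => //; [rewrite e setUC | rewrite eq_sym].
move=> ab ba' ab'; have := ccw_lt a' b'; have := ab; rewrite -(ccw_gt0 a').
have : ccw a' b' <> 1 by move=> /ordS_ccw/eqP; rewrite (negPf ba').
have : ccw b' a' <> 1 by move=> /ordS_ccw/eqP; rewrite (negPf ab').
ccw_lia_from a'.
Qed.

Lemma noncrossing a b c d : [set a; b] \in D -> [set c; d] \in D ->
  ~ (0 < ccw a c /\ ccw a c < ccw a b < ccw a d).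
Proof.
case/andP: dissD => _ /forall_inP h /h /forall_inP {}h /h /negP {}h.
case=> h1 /andP[h2 h3]; apply: h; apply/existsP; exists a; apply/existsP; exists b.
by apply/existsP; exists c; apply/existsP; exists d; rewrite !eqxx h1 h2 h3.
Qed.

Lemma subgon_card Q : subgon D Q -> 2 < #|Q|.
Proof. by case/and3P. Qed.

Lemma subgon_side Q a b : subgon D Q -> next_in Q a b ->
  ccw a b = 1 \/ [set a; b] \in D.
Proof.
case/and3P=> Q3 /forallP h _ nab; have /implyP/(_ _)/orP[|/existsP[c /eqP e]|] := h [set a; b].
- by apply/existsP; exists a; apply/existsP; exists b; rewrite nab eqxx.
- left; case: (set2_eq e) => -[ha hb]; subst; first by rewrite ccw_ordS //; lia.
  (* Here the side of [P] runs from [b] to [a], so the way from [a] to [b] passes all other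
     vertices, among them a third vertex of [Q]. *)
  case/nextP: nab => _ _ _ k; have [d dQ /andP[d1 d2]] := third_vertex (ordS c) c Q3.
  have := k d dQ; have : ccw c (ordS c) = 1 by rewrite ccw_ordS //; lia.
  ccw_lia_from c.
- by right.
Qed.

Lemma subgon_chord Q a b : subgon D Q -> a \in Q -> b \in Q ->
  [set a; b] \in D -> next_in Q a b \/ next_in Q b a.
Proof.
case/and3P=> _ _ /forall_inP h aQ bQ /h /implyP k.
have /existsP[c /existsP[d /andP[n1 /eqP e]]] : subpolygon_side Q [set a; b].
  by apply: k; apply/subsetP => v /set2P[]->.
by case: (set2_eq e) => -[ha hb]; subst; auto.
Qed.

(** A vertex [q] of [Q] outside [N] lies over a side [x y] of [N], which is then a diagonal. A
    vertex of [Q] beyond it would force [x] and [y] into [Q], lest a side of [Q] cross the diagonal,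
    and then the diagonal would cut [Q]. *)
Lemma subgon_in_arc N Q : subgon D N -> subgon D Q -> Q != N ->
  exists x y, next_in N x y /\ Q \subset ccw_arc x y.
Proof.
move=> sN sQ QN; have N3 := subgon_card sN; have Q3 := subgon_card sQ.
have [QsN|] := boolP (Q \subset N); last first.
  case/subsetPn=> q qQ qN; have [x [y [nxy hq]]] := gap_ex N3 qN.
  exists x, y; split=> //; apply/subsetP => r rQ; rewrite in_arc leqNgt.
  apply/negP => hr.
  have [xy1|xyD] := subgon_side sN nxy; first by ccw_lia.
  (* A side [s t] of [Q] passing over [y] has neither [q] nor [r] strictly inside its arc, so it is
     a diagonal crossing [x y]. *)
  have yQ : y \in Q.
    apply/negPn/negP => /(gap_ex Q3)[s [t [nst hy]]].
    have [st1|stD] := subgon_side sQ nst; first by ccw_lia.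
    case/nextP: nst => _ _ _ h; have hhq := h q qQ; have hhr := h r rQ.
    by apply: (noncrossing xyD stD); move: hq hr hy hhq hhr; ccw_lia_from x.
  have xQ : x \in Q.
    apply/negPn/negP => /(gap_ex Q3)[s [t [nst hy]]].
    have [st1|stD] := subgon_side sQ nst; first by ccw_lia.
    case/nextP: nst => _ _ _ h; have hhq := h q qQ; have hhr := h r rQ.
    by rewrite setUC in stD; apply: (noncrossing xyD stD); ccw_lia_from x.
  have [] := subgon_chord sQ xQ yQ xyD => /nextP[_ _ _ h].
    by apply: (h q).
  by apply: (h r rQ); ccw_lia_from x.
(* Now [Q] is a subset of [N]. If no side of [Q] is a side of [N] run backwards, no vertex of [N] is
   missing from [Q]: the side of [Q] passing over it is a diagonal between vertices of [N], hence a
   side of [N], which forwards skips no vertex and backwards is excluded. *)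
have [/existsP[x /existsP[y /andP[nQ nN]]]|/existsPn H] :=
    boolP [exists x, exists y, next_in Q x y && next_in N y x].
  exists y, x; split=> //; apply/subsetP => r rQ; rewrite in_arc.
  by case/nextP: nQ => _ _ xy /(_ r rQ); ccw_lia_from y.
case/eqP: QN; apply/eqP; rewrite eqEsubset QsN /=; apply/subsetP => v vN.
apply/negPn/negP => /(gap_ex Q3)[s [t [nst hv]]].
have [sQ' tQ _ _] := nextP _ _ _ nst.
have [st1|stD] := subgon_side sQ nst; first by ccw_lia.
have [/nextP[_ _ _ h]|nts] :=
  subgon_chord sN (subsetP QsN _ sQ') (subsetP QsN _ tQ) stD; first by apply: (h v).
by have /existsPn/(_ t) := H s; rewrite nst nts.
Qed.

(* Q is the set of vertices on the left of the edge from x to y that are not cut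
   off by any other diagonal on that side. *)
Lemma subgon_edge_ex x y : ccw x y < n.-1 -> (ccw x y == 1) || ([set x; y] \in D) ->
  exists Q, subgon D Q && next_in Q x y.
Proof.
move=> lxy exy.
(* Positions are measured from [y], since the left of the edge is the arc from [y] to [x]. The last
   condition keeps the edge itself from cutting off vertices. *)
pose P v c d := [&& [set c; d] \in D, ccw y c < ccw y v, ccw y v < ccw y d,
  ccw y d <= ccw y x & (c != y) || (d != x)].
pose N := [set v | (ccw y v <= ccw y x) && ~~ [exists c, exists d, P v c d]].
have nxy : x != y.
  apply: contraTneq exy => ->; rewrite ccwxx /=; apply/negP => /diag_ccw.
  by rewrite ccwxx.
have inN v : reflect (ccw y v <= ccw y x /\
    forall c d, [set c; d] \in D -> ccw y c < ccw y v < ccw y d ->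
      ccw y d <= ccw y x -> c = y /\ d = x) (v \in N).
  rewrite inE; apply: (iffP andP) => -[h1 h2]; split=> //.
    move=> c d cdD /andP[h3 h4] h5; move/existsPn/(_ c)/existsPn/(_ d): h2.
    rewrite /P cdD h3 h4 h5 /= -negb_and negbK => /andP[/eqP-> /eqP->] //.
  apply/existsPn => c; apply/existsPn => d; apply/and5P => -[h3 h4 h5 h6].
  by have [||->->] := h2 c d h3 => //; rewrite ?h4 ?h5 ?eqxx.
have yN : y \in N by apply/inN; rewrite ccwxx; split=> // c d _; ccw_lia.
have xN : x \in N by apply/inN; split=> // c d _; ccw_lia.
(* The vertex of N after s is the farthest end of a diagonal from s, if any. *)
have nextN s : s \in N -> s != x -> exists t, [/\ t \in N, ccw y s < ccw y t,
    ccw s t = 1 \/ ([set s; t] \in D) /\ (s != y \/ t != x) &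
    forall v, v \in N -> ~ (ccw y s < ccw y v < ccw y t)].
  move=> sN sx; have [slx hs] := inN _ sN.
  pose C t := [&& [set s; t] \in D, ccw y s < ccw y t, ccw y t <= ccw y x &
      (s != y) || (t != x)].
  have [t0 Ct0|noC] := pickP C.
    case: (@arg_maxnP _ t0 C (ccw y) Ct0) => t /and4P[stD st tx nst] tmax.
    exists t; split=> //; first last.
    - move=> v /inN[_ hv] h; have [e1 e2] := hv s t stD h tx.
      by move: nst; rewrite e1 e2 !eqxx.
    - by right; split=> //; apply/orP.
    apply/inN; split=> // c d cdD hcd dx.
    have [cs|cs] := ltnP (ccw y c) (ccw y s).
      by apply: hs => //; ccw_lia.
    have [/ccw_inj cs'|/eqP cs'] := eqVneq (ccw y c) (ccw y s).
      subst c; have [/andP[/eqP-> /eqP->] //|ndx] := boolP ((s == y) && (d == x)).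
      have sd : ccw y s < ccw y d by ccw_lia.
      by have := tmax d; rewrite /C cdD dx sd -negb_and ndx => /(_ isT); ccw_lia.
    have [] := noncrossing stD cdD; ccw_lia_from y.
  have hS : ccw s (ordS s) = 1 by rewrite ccw_ordS //; ccw_lia.
  have yS : ccw y (ordS s) = (ccw y s).+1 by ccw_lia_from y.
  exists (ordS s); split=> //; first (apply/inN; split).
  - by ccw_lia_from y.
  - move=> c d cdD hcd dx; have [cs|cs] := ltnP (ccw y c) (ccw y s).
      by apply: hs => //; ccw_lia.
    have cs' : c = s by apply: (@ccw_inj _ y); ccw_lia.
    subst c; have := noC d; rewrite /C cdD dx.
    have -> : ccw y s < ccw y d by ccw_lia.
    by rewrite /= -negb_and => /negbFE/andP[/eqP-> /eqP->].
  - by rewrite yS.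
  - by left.
  - by move=> v _; ccw_lia.
have Nnext s t : s \in N -> t \in N -> ccw y s < ccw y t ->
    (forall v, v \in N -> ~ (ccw y s < ccw y v < ccw y t)) -> next_in N s t.
  move=> sN tN st h; apply/nextP; split=> //.
    by apply: contraTneq st => ->; rewrite ltnn.
  by move=> v vN hv; apply: (h v vN); have [? _] := inN _ tN; have [? _] := inN _ vN;
     ccw_lia_from y.
have nNxy : next_in N x y.
  by apply/nextP; split=> // v /inN[h _]; ccw_lia_from y.
exists N; rewrite nNxy andbT; apply/and3P; split.
(* The vertex [t] of [N] after [y] is not [x]: the edge itself was excluded from the choice of [t],
   and [ccw y x] exceeds 1 by [lxy]. So [x], [y], [t] are three vertices. *)
- have [t [tN st e _]] := nextN y yN ltac:(by rewrite eq_sym).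
  have tx : t != x.
    by apply/eqP => tx; subst t; case: e => [|[_ []]]; rewrite ?eqxx //; ccw_lia_from y.
  have /subset_leq_card : [set x; y; t] \subset N.
    by rewrite !subUset !sub1set xN yN tN.
  apply: leq_trans; rewrite setUC cardsU1 !inE negb_or tx cards2 nxy.
  by have -> : t != y by apply: contraTneq st => ->; rewrite ltnn.
- apply/forallP => e; apply/implyP => /existsP[a /existsP[b /andP[nab /eqP->]]].
  have [ax|ax] := eqVneq a x.
    subst a; rewrite (next_uniq nab nNxy); case/orP: exy => [/eqP h|->]; rewrite ?orbT //.
    by apply/orP; left; apply/existsP; exists x; rewrite -(ordS_ccw h).
  have [aN bN _ _] := nextP _ _ _ nab.
  have [t [tN st e' h]] := nextN a aN ax.
  rewrite (next_uniq nab (Nnext _ _ aN tN st h)); case: e' => [h'|[-> _]]; rewrite ?orbT //.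
  by apply/orP; left; apply/existsP; exists a; rewrite -(ordS_ccw h').
- apply/forall_inP => e eD; apply/implyP => eN.
  have [a [b [ab E]]] : exists a b, ccw y a < ccw y b /\ e = [set a; b].
    case/andP: dissD => /forall_inP /(_ e eD) /existsP[a /existsP[b /and4P[/eqP-> ab _ _]]] _.
    have [h|h|/ccw_inj h] := ltngtP (ccw y a) (ccw y b).
    + by exists a, b.
    + by exists b, a; rewrite setUC.
    + by rewrite h eqxx in ab.
  subst e; move: eN; rewrite subUset !sub1set => /andP[aN bN].
  have [/andP[/eqP-> /eqP->]|/negP nab] := boolP ((a == y) && (b == x)).
    by apply/existsP; exists x; apply/existsP; exists y; rewrite nNxy setUC eqxx.
  apply/existsP; exists a; apply/existsP; exists b; rewrite eqxx andbT.
  apply: Nnext => // v /inN[_ h] hv; apply: nab.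
  by have [||->->] := h a b eD; rewrite ?eqxx //; case/inN: bN.
Qed.

(** Otherwise [Q] lies over one side of [N], which joins [x] and [y] as these are vertices of both.
    In either direction, one of the two polygons is confined to the arc from [x] to [y] and has no
    third vertex. *)
Lemma subgon_edge_uniq Q N x y : subgon D Q -> subgon D N ->
  next_in Q x y -> next_in N x y -> Q = N.
Proof.
move=> sQ sN nQ nN; apply/eqP/negPn/negP => QN.
have [s [t [nst /subsetP h]]] := subgon_in_arc sN sQ QN.
have [xQ yQ xy hQ] := nextP _ _ _ nQ; have [xN yN _ hN] := nextP _ _ _ nN.
have [sN' tN st hst] := nextP _ _ _ nst.
have := h x xQ; have := h y yQ; rewrite !in_arc => hy hx.
have h1 := hst x xN; have h2 := hst y yN.
have [/eqP|xs] := eqVneq x s.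
  move=> /eqP xs; subst s; rewrite (next_uniq nst nN) in h.
  by apply: (next_arc_card nQ (subgon_card sQ)); apply/subsetP.
have xt : x = t by apply: (@ccw_inj _ s); ccw_lia_from s.
subst t; have ys : y = s by apply: (@ccw_inj _ s); ccw_lia_from s.
subst s; apply: (next_arc_card nN (subgon_card sN)); apply/subsetP => v vN.
by rewrite in_arc; case/nextP: nst => _ _ _ /(_ v vN); ccw_lia_from x.
Qed.

(** * Subgons and arcs between two vertices of a subgon *)

Definition between x y := traject (@ordS n) (ordS x) (ccw x y).-1.

(** [Q] lies over a single side of [N]; the closed arc of that side contains the vertex [y] of [N],
    so [y] is one of its ends. *)
Lemma subgon_at_vertex N Q y p q : subgon D N -> subgon D Q -> Q != N ->
  y \in Q -> next_in N p y -> next_in N y q ->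
  Q \subset ccw_arc p y \/ Q \subset ccw_arc y q.
Proof.
move=> sN sQ QN yQ np nq.
have [s [t [nst Qst]]] := subgon_in_arc sN sQ QN.
have [yN _ _ _] := nextP _ _ _ nq; have [_ _ st h] := nextP _ _ _ nst.
have := subsetP Qst y yQ; rewrite in_arc => hy; have hy' := h y yN.
have [e|ys] := eqVneq y s; first by subst s; rewrite (next_uniq nst nq) in Qst; right.
have e : y = t by apply: (@ccw_inj _ s); ccw_lia_from s.
by subst t; rewrite (prev_uniq nst np) in Qst; left.
Qed.

Lemma arc_next_subl N x p y : x \in N -> x != y -> next_in N p y ->
  ccw_arc p y \subset ccw_arc x y.
Proof.
move=> xN xy /nextP[_ _ py h]; have hx := h x xN; apply/subsetP => v.
rewrite !in_arc => hv; ccw_lia_from x.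
Qed.

Lemma arc_next_subr N y q z : z \in N -> y != z -> next_in N y q ->
  ccw_arc y q \subset ccw_arc y z.
Proof.
move=> zN yz /nextP[_ _ yq h]; have hz := h z zN; apply/subsetP => v.
rewrite !in_arc => hv; ccw_lia_from y.
Qed.

(** The side [s t] of [N] over which [Q] lies decides: [s] before [y] gives the first arc, [s] from
    [y] on but before [z] the second, and [s] from [z] on would put [Q] in two arcs that meet only
    in their ends. *)
Lemma subgon_arc_split N Q x y z : subgon D N -> subgon D Q -> Q != N ->
  x \in N -> y \in N -> z \in N -> 0 < ccw x y < ccw x z ->
  Q \subset ccw_arc x z -> (Q \subset ccw_arc x y) || (Q \subset ccw_arc y z).
Proof.
move=> sN sQ QN xN yN zN hy Qxz.
have [s [t [nst Qst]]] := subgon_in_arc sN sQ QN.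
have [sN' tN st h] := nextP _ _ _ nst.
have hx := h x xN; have hy' := h y yN; have hz := h z zN.
have [sy|ys] := ltnP (ccw x s) (ccw x y).
  apply/orP; left; apply: (subset_trans Qst); apply/subsetP => v; rewrite !in_arc => hv.
  by clear hx hz; ccw_lia_from x.
have [sz|zs] := ltnP (ccw x s) (ccw x z).
  apply/orP; right; apply: (subset_trans Qst); apply/subsetP => v; rewrite !in_arc => hv.
  by clear hy'; ccw_lia_from x.
have Qzx : Q \subset ccw_arc z x.
  apply: (subset_trans Qst); apply/subsetP => v; rewrite !in_arc => hv.
  by clear hy' hz; ccw_lia_from x.
by case: (arc_cap_card (subgon_card sQ) Qxz Qzx); ccw_lia_from x.
Qed.

Definition inner N x z := [set v in N | 0 < ccw x v < ccw x z].

Lemma card_inner_split N x y z : y \in N -> 0 < ccw x y < ccw x z ->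
  #|inner N x z| = #|inner N x y| + 1 + #|inner N y z|.
Proof.
move=> yN hy; rewrite -(cardsID (inner N x y) (inner N x z)) -addnA; congr (_ + _).
  congr #|pred_of_set _|; apply/setP => v; rewrite !inE; case: (v \in N) => //=.
  by apply/idP/idP; ccw_lia_from x.
rewrite (cardsD1 y) !inE yN; congr (_ + _).
  by rewrite hy ltnn andbF.
congr #|pred_of_set _|; apply/setP => v; rewrite !inE; case: (v \in N); rewrite ?andbF //=.
by have [->|] := eqVneq v y => /=; rewrite ?ccwxx // => vy; apply/idP/idP; ccw_lia_from x.
Qed.

Lemma card_inner_next N x z : next_in N x z -> #|inner N x z| = 0.
Proof.
move=> /nextP[_ _ _ h]; apply/eqP; rewrite cards_eq0; apply/eqP/setP => v.
by rewrite !inE; apply/andP => -[/h].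
Qed.

Lemma card_inner_full N x z : next_in N z x -> #|inner N x z| = #|N| - 2.
Proof.
move=> /nextP[zN xN zx h]; rewrite (cardsD1 x N) (cardsD1 z (N :\ x)) !inE xN zN zx /=.
rewrite !addnA addKn; congr #|pred_of_set _|; apply/setP => v; rewrite !inE.
have [vN|] := boolP (v \in N); rewrite ?andbF //=; have hv := h v vN.
have [->|vz] := eqVneq v z; first by rewrite /= ltnn andbF.
have [->|vx] := eqVneq v x; first by rewrite /= ccwxx.
by apply/idP => /=; ccw_lia_from x.
Qed.

Lemma ccw_ordSr x a : (ccw x a).+1 < n -> ccw x (ordS a) = (ccw x a).+1.
Proof.
move=> h; have e : ccw a (ordS a) = 1 by rewrite ccw_ordS //; lia.
ccw_lia_from x.
Qed.

Lemma ccw_iter x k : k < n -> ccw x (iter k (@ordS n) x) = k.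
Proof.
elim: k => [|k IH] kn; first exact: ccwxx.
by rewrite /= ccw_ordSr IH //; lia.
Qed.

Lemma iter_ccw x y : iter (ccw x y) (@ordS n) x = y.
Proof. by apply: (@ccw_inj _ x); rewrite ccw_iter // ccw_lt. Qed.

Lemma mem_between x y v : v \in between x y -> 0 < ccw x v < ccw x y.
Proof.
case/trajectP => k hk ->; rewrite -iterSr; have hn := ccw_lt x y.
by rewrite ccw_iter; lia.
Qed.

Lemma between_split x y z : 0 < ccw x y < ccw x z ->
  between x z = between x y ++ y :: between y z.
Proof.
move=> h; rewrite /between.
have -> : (ccw x z).-1 = (ccw x y).-1 + (ccw y z).-1.+1 by ccw_lia_from x.
rewrite trajectD trajectS -iterSr prednK; last by lia.
by rewrite iter_ccw.
Qed.

Lemma between_ordS x z : 1 < ccw x z -> between x z = ordS x :: between (ordS x) z.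
Proof.
move=> h; have e : ccw x (ordS x) = 1 by rewrite ccw_ordS //; lia.
by rewrite (@between_split x (ordS x) z) ?e // /between e.
Qed.

(** * Sums over matchings, taken one vertex at a time *)

Variable R : realType.
Implicit Types (c d : {set 'I_n} -> nat) (ps : seq 'I_n) (f g : seq {set 'I_n} -> R).
Local Open Scope ring_scope.

(** The iterated form lets the recurrences peel off the first vertex; the weight [f] absorbs the
    entries already chosen. *)
Fixpoint match_sum f ps : R :=
  if ps is p :: ps' then
    \sum_(Q | subgon D Q && (p \in Q)) match_sum (fun w => f (Q :: w)) ps'
  else f [::].

Lemma match_sum_cons f p ps : match_sum f (p :: ps) =
  \sum_(Q | subgon D Q && (p \in Q)) match_sum (fun w => f (Q :: w)) ps.
Proof. by []. Qed.

Lemma eq_match_sum f g ps : f =1 g -> match_sum f ps = match_sum g ps.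
Proof.
elim: ps f g => [|p ps IH] f g fg /=; first exact: fg.
by apply: eq_bigr => Q _; apply: IH => w; apply: fg.
Qed.

Lemma match_sum_linear (k l : R) f g ps :
  match_sum (fun w => k * f w + l * g w) ps = k * match_sum f ps + l * match_sum g ps.
Proof.
elim: ps f g => [|p ps IH] f g //=.
by rewrite !mulr_sumr -big_split; apply: eq_bigr => Q _; rewrite IH.
Qed.

Lemma match_sum0 ps : match_sum (fun=> 0) ps = 0.
Proof. by elim: ps => //= p ps IH; rewrite big1. Qed.

Lemma big_matchings f i j :
  \sum_(w in matchings D i j) f w = match_sum f (between i j).
Proof.
rewrite /between /matchings; move: (ccw i j).-1 => m.
under eq_bigl do rewrite inE.
elim: m i f => [|m IH] i f /=.
  rewrite (big_pred1 [tuple]) //= => w; rewrite (tuple0 w) /= [RHS]eqxx.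
  by apply/forallP => -[].
rewrite (reindex (fun p : {set 'I_n} * m.-tuple {set 'I_n} => cons_tuple p.1 p.2)) /=.
  rewrite -(eq_bigr _ (fun Q _ => IH (ordS i) (fun w => f (Q :: w)))) pair_big_dep /=.
  apply: eq_bigl => -[Q w] /=; apply/forallP/andP => [h|[h /forallP h'] k].
    split; first by have := h ord0; rewrite (tnth_nth set0).
    apply/forallP => k; have := h (lift ord0 k).
    by rewrite !(tnth_nth set0) /= -!iterS -iterSr.
  have [k' ->|->] := unliftP ord0 k; last by rewrite (tnth_nth set0).
  by have := h' k'; rewrite !(tnth_nth set0) /= -!iterS -iterSr.
exists (fun w => (thead w, [tuple of behead w])) => [[Q w] _|w _] /=.
  by congr pair; apply: val_inj.
by rewrite [RHS]tuple_eta; apply: val_inj.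
Qed.

(** * Recurrence for local weights *)

Lemma wtL_run_rec Q k w : wtL_run R Q k.+2 w =
  lambda R #|Q| * wtL_run R Q k.+1 w - wtL_run R Q k w.
Proof.
elim: w k => [|Q' w IH] k /=; first exact: chebU_rec.
by case: eqP => // _; rewrite chebU_rec mulrBl mulrA.
Qed.

(** Prepending [Q] either starts a new run, with factor U_1, or lengthens the first run, where the
    Chebyshev recursion subtracts the weight of the word with two copies of [Q] fewer. *)
Lemma wtL_cons Q w : wtL R (Q :: w) = lambda R #|Q| * wtL R w -
  (if w is Q' :: w' then if Q' == Q then wtL R w' else 0 else 0).
Proof.
have run0 u : wtL_run R Q 0 u = wtL R u.
  by case: u => [|Q1 u] /=; rewrite ?hornerE //; case: eqP => [->|]; rewrite ?mul1r.
case: w => [|Q' w]; first by rewrite /= hornerE mulr1 subr0.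
rewrite [LHS]/=; case: eqP => [->|_]; first by rewrite wtL_run_rec run0.
by rewrite subr0 /= hornerE.
Qed.

Definition lambda_sum v : R := \sum_(Q | subgon D Q && (v \in Q)) lambda R #|Q|.

Lemma match_sum_wtL1 p : match_sum (@wtL R n) [:: p] = lambda_sum p.
Proof. by apply: eq_bigr => Q _; rewrite /= hornerE. Qed.

(** Edges are oriented with the subgon on their left, so a diagonal yields one subgon for each
    direction, a side of [P] one for its counterclockwise direction only. *)
Lemma edge_subgon x y : (ccw x y == 1)%N || ([set x; y] \in D) ->
  exists Q0, forall Q, subgon D Q && next_in Q x y = (Q == Q0).
Proof.
move=> e; have [|Q0 /andP[s0 n0]] := subgon_edge_ex _ e.
  by case/orP: e => [/eqP->|/diag_ccw/andP[]] //; lia.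
exists Q0 => Q; apply/andP/eqP => [[sQ nQ]|-> //].
exact: (subgon_edge_uniq sQ s0 nQ n0).
Qed.

Lemma next_ordS Q p : next_in Q p (ordS p) = (p \in Q) && (ordS p \in Q).
Proof.
have c1 : ccw p (ordS p) = 1%N by rewrite ccw_ordS //; lia.
apply/nextP/andP => [[]//|[pQ sQ]]; split=> //.
  by rewrite -ccw_gt0 c1.
by move=> c _; rewrite c1; lia.
Qed.

(** The subtracted terms of [wtL_cons] survive only when the first two entries agree, that is for a
    subgon at both [p] and [ordS p]; the only one is the subgon on the side joining them. *)
Lemma match_sum_wtL_rec p ps :
  match_sum (@wtL R n) (p :: ordS p :: ps) =
  lambda_sum p * match_sum (@wtL R n) (ordS p :: ps) - match_sum (@wtL R n) ps.
Proof.
have [|Q0 hQ0] := @edge_subgon p (ordS p).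
  by rewrite ccw_ordS ?eqxx //; lia.
rewrite match_sum_cons (eq_bigr (fun Q => lambda R #|Q| * match_sum (@wtL R n) (ordS p :: ps)
   + (-1) * \sum_(Q' | subgon D Q' && (ordS p \in Q'))
      match_sum (fun w => if Q' == Q then wtL R w else 0) ps)); last first.
  move=> Q _; rewrite !match_sum_cons mulr_sumr mulr_sumr -big_split; apply: eq_bigr => Q' _.
  apply: (etrans _ (match_sum_linear _ _ _ _ _)); apply: eq_match_sum => w.
  by rewrite wtL_cons mulN1r.
rewrite big_split /= -mulr_suml; congr (_ + _).
rewrite -mulr_sumr mulN1r; congr (- _).
rewrite (eq_bigr (fun Q => if ordS p \in Q then match_sum (@wtL R n) ps else 0)).
  rewrite -big_mkcondr (big_pred1 Q0) // => Q.
  by rewrite [RHS]/= -hQ0 next_ordS andbA.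
move=> Q /andP[sQ pQ]; case: ifP => h.
  rewrite (bigD1 Q) ?sQ //= eqxx big1 ?addr0 // => Q' /andP[_ /negPf->].
  exact: match_sum0.
rewrite big1 // => Q' /andP[_ h']; case: eqP => [e|_]; last exact: match_sum0.
by rewrite -e h' in h.
Qed.

(** * Traditional weights as a linear map on truncated monomials *)

Definition truncU Q k : R :=
  if (k <= #|Q| - 2)%N then (chebU R k).[lambda R #|Q|] else 0.

Lemma truncU0 Q : truncU Q 0 = 1.
Proof. by rewrite /truncU /= hornerE. Qed.

Lemma truncU_max Q : (2 < #|Q|)%N -> truncU Q (#|Q| - 2) = 1.
Proof. by move=> Q3; rewrite /truncU leqnn chebU_sub2. Qed.

Lemma truncU1 Q : (2 < #|Q|)%N -> truncU Q 1 = lambda R #|Q|.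
Proof. by move=> Q3; rewrite /truncU ifT ?hornerE //; lia. Qed.

(** As U_(|Q|-1) vanishes, truncation respects the recursion up to that index. At index |Q| it gives
    0 instead of -U_(|Q|-2) = -1, whence the correction; further on all terms are 0. *)
Lemma truncU_rec Q k : (2 < #|Q|)%N ->
  truncU Q k.+2 = lambda R #|Q| * truncU Q k.+1 - truncU Q k + (k.+2 == #|Q|)%:R.
Proof.
move=> Q3; rewrite /truncU; case: (ltngtP k.+2 #|Q|) => h.
- have -> : (k.+1 <= #|Q| - 2)%N by lia.
  have -> : (k <= #|Q| - 2)%N by lia.
  rewrite addr0 -chebU_rec; case: leqP => // h'.
  have -> : k.+2 = (#|Q| - 1)%N by lia.
  by rewrite chebU_sub1.
- by rewrite !ifF ?mulr0 ?subr0 ?addr0 //; lia.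
- have -> : k = (#|Q| - 2)%N by lia.
  by rewrite leqnn chebU_sub2 // !ifF ?mulr0 ?sub0r ?addNr //; lia.
Qed.

Definition count_wt c : R := \prod_(Q | subgon D Q) truncU Q (c Q).

Lemma wtT_count w : wtT R D w = count_wt (fun Q => count_mem Q w).
Proof.
rewrite /wtT /count_wt; case: ifP => [/existsP[Q /andP[sQ h]]|/negbT/existsPn h].
  by rewrite (bigD1 Q) //= /truncU leqNgt h mul0r.
apply: eq_bigr => Q sQ; have := h Q; rewrite sQ /= -leqNgt /truncU => ->.
by [].
Qed.

(** [c] is the exponent vector of a monomial multiplied into the product of the factors of the
    vertices in [ps]. *)
Definition count_sum c ps : R :=
  match_sum (fun w => count_wt (fun Q => (c Q + count_mem Q w)%N)) ps.

Lemma eq_count_wt c d : (forall Q, subgon D Q -> c Q = d Q) ->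
  count_wt c = count_wt d.
Proof. by move=> h; apply: eq_bigr => Q /h ->. Qed.

Lemma eq_count_sum c d ps : (forall Q, subgon D Q -> c Q = d Q) ->
  count_sum c ps = count_sum d ps.
Proof.
by move=> h; apply: eq_match_sum => w; apply: eq_count_wt => Q /h ->.
Qed.

Lemma count_sum_nil c : count_sum c [::] = count_wt c.
Proof. by apply: eq_count_wt => Q _; rewrite /= addn0. Qed.

Lemma count_sum_cons c p ps : count_sum c (p :: ps) =
  \sum_(Q | subgon D Q && (p \in Q)) count_sum (fun Q' => c Q' + (Q' == Q))%N ps.
Proof.
apply: eq_bigr => Q _; apply: eq_match_sum => w; apply: eq_count_wt => Q' _.
by rewrite /= addnA eq_sym.
Qed.

Lemma count_sum_over Q c ps : subgon D Q -> (#|Q| - 2 < c Q)%N -> count_sum c ps = 0.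
Proof.
move=> sQ h; rewrite /count_sum -(match_sum0 ps); apply: eq_match_sum => w.
by rewrite /count_wt (bigD1 Q) //= /truncU leqNgt (leq_trans h (leq_addr _ _)) mul0r.
Qed.

(** The linear map is multiplicative on products without a common variable: the subgons counted by
    [d] occur neither in [c] nor at a vertex of [ps]. *)
Lemma count_sum_factor c d ps :
  (forall Q, subgon D Q -> (0 < d Q)%N ->
     c Q = 0 /\ forall p, p \in ps -> p \notin Q) ->
  count_sum (fun Q => c Q + d Q)%N ps = count_wt d * count_sum c ps.
Proof.
elim: ps c => [|p ps IH] c h.
  rewrite !count_sum_nil /count_wt -big_split; apply: eq_bigr => Q sQ /=.
  have [e|d0] := posnP (d Q); first by rewrite e addn0 truncU0 mul1r.
  by have [-> _] := h Q sQ d0; rewrite truncU0 mulr1.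
rewrite !count_sum_cons mulr_sumr; apply: eq_bigr => Q /andP[sQ pQ].
rewrite -IH; first by apply: eq_count_sum => Q' _; rewrite addnAC.
move=> Q' sQ' d0; have [c0 hp] := h Q' sQ' d0; split; last first.
  by move=> p' hp'; apply: hp; rewrite inE hp' orbT.
rewrite c0; case: eqP => // e; subst Q'.
by have := hp p (mem_head _ _); rewrite pQ.
Qed.

(* The exponent of x_Q in the product of the factors of the vertices strictly
   between two vertices x and z of the subgon N. *)
Definition arc_count N x z Q : nat :=
  if Q == N then #|inner N x z|
  else if Q \subset ccw_arc x z then (#|Q| - 2)%N else 0%N.

(** Induction on the length of the arc. A vertex [y] of [N] inside it splits it into two arcs whose
    factors multiply to monomials by induction. Without such a [y], the arc is a side of [P], or it
    belongs to a diagonal and the subgon on the arc's side of this diagonal takes the place of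
    [N]. *)
Lemma count_sum_arc N x z c ps : subgon D N -> x \in N -> z \in N -> x != z ->
  count_sum c (between x z ++ ps) = count_sum (fun Q => c Q + arc_count N x z Q)%N ps.
Proof.
elim: {x z}(ccw x z) {-2}x {-2}z (leqnn (ccw x z)) N c ps => [|m IH] x z hm N c ps sN xN zN xz.
  by move: xz; rewrite -ccw_gt0 ltnNge hm.
have key N' y : subgon D N' -> x \in N' -> z \in N' -> y \in N' ->
    (0 < ccw x y < ccw x z)%N -> count_sum c (between x z ++ ps) =
    count_sum (fun Q => c Q + arc_count N' x z Q)%N ps.
  move=> {sN xN zN} sN xN zN yN hy; have N3 := subgon_card sN.
  have xy : x != y by rewrite -ccw_gt0; case/andP: hy.
  have yz : y != z by apply: contraTneq hy => ->; rewrite ltnn andbF.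
  rewrite (between_split hy) -catA cat_cons (IH x y _ N') //; last by clear -hm hy; lia.
  rewrite count_sum_cons (eq_bigr (fun Q =>
    count_sum (fun Q' => c Q' + arc_count N' x y Q' + (Q' == Q) + arc_count N' y z Q')%N ps));
    last by move=> Q _; rewrite (IH y z _ N') //; clear -hm hy n_ge3; ccw_lia_from x.
  have [p np] := prev_ex yN xN ltac:(by rewrite eq_sym).
  have [q nq] := next_ex yN xN ltac:(by rewrite eq_sym).
  (* At [y] only the choice [N'] survives: any other subgon there lies in one of the two arcs, where
     it has its top exponent already. *)
  rewrite (bigD1 N') ?sN //= big1 ?addr0 => [|Q /andP[/andP[sQ yQ] QN]].
    apply: eq_count_sum => Q sQ; rewrite /arc_count; case: (eqVneq Q N') => [->|QN].
      by rewrite (card_inner_split yN hy) /= !addnA.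
    have Q3 := subgon_card sQ.
    have [Qxz|Qxz] := boolP (Q \subset ccw_arc x z).
      have := subgon_arc_split sN sQ QN xN yN zN hy Qxz.
      have [Qxy|_] := boolP (Q \subset ccw_arc x y);
        have [Qyz|_] := boolP (Q \subset ccw_arc y z); rewrite ?addn0 // => _.
      by case: (arc_cap_card Q3 Qxy Qyz); clear -hy n_ge3; ccw_lia_from x.
    have [Qxy|_] := boolP (Q \subset ccw_arc x y).
      case/negP: Qxz; apply: (subset_trans Qxy); apply/subsetP => v.
      by rewrite !in_arc; clear -hy; ccw_lia.
    have [Qyz|_] := boolP (Q \subset ccw_arc y z).
      case/negP: Qxz; apply: (subset_trans Qyz); apply/subsetP => v.
      by rewrite !in_arc; clear -hy; ccw_lia_from x.
    by rewrite !addn0.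
  have Q3 := subgon_card sQ.
  apply: (@count_sum_over Q) => //; rewrite /arc_count (negPf QN) eqxx.
  have over (k l r s : nat) : s = k \/ s = r -> (s < l + k + 1 + r)%N by clear; lia.
  apply: over; have [Qs|Qs] := subgon_at_vertex sN sQ QN yQ np nq.
    by left; rewrite (subset_trans Qs (arc_next_subl xN xy np)).
  by right; rewrite (subset_trans Qs (arc_next_subr zN yz nq)).
have [y|noy] := pickP (mem (inner N x z)).
  by rewrite !inE => /andP[yN hy]; apply: key yN hy.
have nxz : next_in N x z.
  by apply/nextP; split=> // v vN hv; have := noy v; rewrite !inE vN hv.
have [xz1|xzD] := subgon_side sN nxz.
  rewrite [between x z]/between xz1 /=; apply: eq_count_sum => Q sQ.
  rewrite /arc_count card_inner_next //; case: eqP => _; first by rewrite addn0.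
  case: ifP => [/subsetP h|_]; last by rewrite addn0.
  have [v vQ /andP[vx vz]] := third_vertex x z (subgon_card sQ).
  by have := h v vQ; rewrite in_arc; ccw_lia_from x.
have [|N' /(_ N')] := edge_subgon (x := z) (y := x).
  by rewrite setUC xzD orbT.
rewrite eqxx => /andP[sN' nzx]; have [zN' xN' _ h] := nextP _ _ _ nzx.
have [y yN' /andP[yx yz]] := third_vertex x z (subgon_card sN').
have hy : (0 < ccw x y < ccw x z)%N by have := h y yN'; ccw_lia_from x.
(* The exponent vectors for [N'] and [N] agree: all vertices of [N'] other than [x] and [z] are
   inside the arc, so [N'] has its top exponent |N'| - 2 in both, and [N] has exponent 0 in both. *)
rewrite (key N' y) //; apply: eq_count_sum => Q sQ; congr (_ + _)%N.
have NN' : N' != N.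
  by apply: contraTneq yN' => ->; have := noy y; rewrite !inE hy andbT => ->.
have sub : N' \subset ccw_arc x z.
  by apply/subsetP => v vN; rewrite in_arc; have := h v vN; clear -xz n_ge3; ccw_lia_from x.
rewrite /arc_count (card_inner_full nzx) (card_inner_next nxz).
case: (eqVneq Q N') => [->|QN']; first by rewrite (negPf NN') sub.
case: (eqVneq Q N) => [->|//]; case: ifP => // h'.
by case: (next_arc_card nxz (subgon_card sN) h').
Qed.

Lemma count_wt_arc Q x z m : subgon D Q ->
  count_wt (fun Q' => m * (Q' == Q) + arc_count Q x z Q')%N =
  truncU Q (m + #|inner Q x z|).
Proof.
move=> sQ; rewrite /count_wt (bigD1 Q) //= big1 ?mulr1 => [|Q' /andP[sQ' QQ']].
  by rewrite /arc_count eqxx muln1.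
rewrite /arc_count (negPf QQ') muln0 add0n; case: ifP => _; last exact: truncU0.
by rewrite truncU_max // (subgon_card sQ').
Qed.

(** [z] is the last vertex of [Q] before [j]. At [z] one may choose [Q] itself, giving the first
    term, or a subgon over the side [z q], giving the second; any other subgon there already has its
    top exponent. Beyond [z] no entry is [Q], so its Chebyshev value factors out. *)
Lemma count_sum_last Q x z q j m : subgon D Q -> x \in Q -> z \in Q ->
  (0 < ccw x z < ccw x j)%N -> (forall v, v \in Q -> ~ (0 < ccw z v < ccw z j)%N) ->
  next_in Q z q ->
  count_sum (fun Q' => m * (Q' == Q))%N (between x j) =
  truncU Q (m.+1 + #|inner Q x z|) * count_sum (fun=> 0%N) (between z j) +
  truncU Q (m + #|inner Q x z|) *
    \sum_(Q' | subgon D Q' && (z \in Q') && (Q' \subset ccw_arc z q))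
      count_sum (fun Q'' => (Q'' == Q') : nat) (between z j).
Proof.
move=> sQ xQ zQ hz hlast nq; have Q3 := subgon_card sQ.
have xz : x != z by rewrite -ccw_gt0; case/andP: hz.
have zx : z != x by rewrite eq_sym.
have [p np] := prev_ex zQ xQ zx.
have away Q' : Q' \subset ccw_arc x z -> forall v, v \in between z j -> v \notin Q'.
  move=> /subsetP s v /mem_between hv; apply/negP => /s; rewrite in_arc => h.
  by clear -hz hv h n_ge3; ccw_lia_from x.
have awayQ v : v \in between z j -> v \notin Q.
  by move=> /mem_between hv; apply/negP => /hlast.
have factor c m' : (forall Q1, subgon D Q1 ->
     (Q1 == Q) || (Q1 \subset ccw_arc x z) -> c Q1 = 0%N) ->
   count_sum (fun Q1 => c Q1 + (m' * (Q1 == Q) + arc_count Q x z Q1))%N (between z j) =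
   truncU Q (m' + #|inner Q x z|) * count_sum c (between z j).
  move=> c0; rewrite -(count_wt_arc _ _ _ sQ); apply: count_sum_factor => Q1 sQ1.
  rewrite /arc_count; case: (eqVneq Q1 Q) (c0 Q1 sQ1) => [-> h _|_ h].
    by split; [exact: h | exact: awayQ].
  rewrite muln0 add0n; case: ifP h => // s h _.
  by split; [exact: h | exact: away].
rewrite (between_split hz) (count_sum_arc _ _ sQ xQ zQ xz).
rewrite count_sum_cons (bigD1 Q) ?sQ //=; congr (_ + _).
  rewrite -(factor (fun=> 0%N)) //; apply: eq_count_sum => Q' _.
  by rewrite add0n mulSn addnC addnA.
rewrite (bigID (fun Q' => Q' \subset ccw_arc z q)) /= addrC big1 ?add0r.
  rewrite mulr_sumr; apply: eq_big => [Q'|Q' /andP[/andP[/andP[sQ' zQ'] QQ'] s]].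
    case: (eqVneq Q' Q) => [->|_]; rewrite ?andbT // andbF.
    by apply/esym/negP => /andP[_] /(next_arc_card nq Q3).
  rewrite -factor // => [|Q1 sQ1].
    by apply: eq_count_sum => Q1 _; rewrite addnC.
  case: (eqVneq Q1 Q') => // -> /orP[h|h]; first by rewrite h in QQ'.
  have s' := subset_trans s (arc_next_subr xQ zx nq).
  by case: (arc_cap_card (subgon_card sQ') h s'); clear -xz n_ge3; ccw_lia_from x.
move=> Q' /andP[/andP[/andP[sQ' zQ'] QQ'] ns].
apply: (@count_sum_over Q') => //; rewrite eqxx /arc_count (negPf QQ').
have [s|s] := subgon_at_vertex sQ sQ' QQ' zQ' np nq; last by rewrite s in ns.
by rewrite (subset_trans s (arc_next_subl xQ xz np)) muln0 addn1.
Qed.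

(** * Recurrence for traditional weights and comparison *)

Definition count_sum_from i j v : R :=
  if (0 < ccw i v < ccw i j)%N then count_sum (fun=> 0%N) (between v j) else 0.

(** Cutting at the last vertex [z] of [Q] before [j] expresses every term through the same two sums
    [X] and [Y], with truncated Chebyshev values as coefficients; comparing coefficients leaves the
    Chebyshev recursion. *)
Lemma count_sum_subgon Q i j : subgon D Q -> i \in Q ->
  count_sum (fun Q' => (Q' == Q) : nat) (between i j) =
  lambda R #|Q| * count_sum (fun=> 0%N) (between i j)
  - \sum_(v | next_in Q i v) count_sum_from i j v
  + \sum_(v | next_in Q v i) count_sum_from i j v.
Proof.
move=> sQ iQ; have Q3 := subgon_card sQ.
have [a aQ /andP[ai _]] := third_vertex i i Q3.
have ia : i != a by rewrite eq_sym.
have [u nu] := next_ex iQ aQ ia; have [u' nu'] := prev_ex iQ aQ ia.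
rewrite (big_pred1 u) => [|v]; last first.
  by apply/idP/eqP => [/next_uniq|->//]; apply.
rewrite (big_pred1 u') => [|v]; last first.
  by apply/idP/eqP => [/prev_uniq|->//]; apply.
have [_ uQ iu hu] := nextP _ _ _ nu; have [u'Q _ u'i hu'] := nextP _ _ _ nu'.
(* Without a vertex of [Q] strictly between [i] and [j], the one copy of [Q] contributes a separate
   factor U_1, and both neighbours give 0. *)
have [z0 z0P|noz] := pickP [pred v in Q | 0 < ccw i v < ccw i j]%N; last first.
  have out v : v \in Q -> (0 < ccw i v < ccw i j)%N = false.
    by move=> vQ; have := noz v; rewrite /= vQ.
  rewrite /count_sum_from !out // subr0 addr0 -(truncU1 Q3).
  transitivity (count_sum (fun Q' => 0 + (Q' == Q))%N (between i j)) => //.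
  rewrite count_sum_factor => [|Q' sQ' h].
    congr (_ * _); rewrite /count_wt (bigD1 Q) //= eqxx big1 ?mulr1 // => Q' /andP[_ /negPf->].
    exact: truncU0.
  split=> // v /mem_between hv; apply/negP => vQ'.
  by move: h vQ'; case: eqP => // -> _ /out; rewrite hv.
have := @arg_maxnP _ z0 [pred v in Q | 0 < ccw i v < ccw i j]%N (ccw i) z0P.
case=> z /andP[zQ hz] zmax; have {}zmax v : v \in Q -> ~ (0 < ccw z v < ccw z j)%N.
  move=> vQ hv; have := zmax v; rewrite /= vQ /=; clear -hz hv n_ge3.
  have h : (0 < ccw i v < ccw i j)%N by ccw_lia_from i.
  by move=> /(_ h); clear h; ccw_lia_from i.
have iz : i != z by rewrite -ccw_gt0; case/andP: hz.
have [q nq] := next_ex zQ iQ ltac:(by rewrite eq_sym).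
have L m := count_sum_last m sQ iQ zQ hz zmax nq.
have := L 0%N; have := L 1%N; set X := count_sum _ (between z j).
set Y := \sum_(Q' | _) _; rewrite add0n.
rewrite (eq_count_sum (d := fun Q' => (Q' == Q) : nat)) => [->|Q' _]; last by rewrite mul1n.
rewrite (eq_count_sum (d := fun=> 0%N)) => [->|Q' _] //.
(* Starting at [u] instead of [i], [Q] has one vertex fewer before [z]; the default 0 is U_(-1),
   reached when [u] is [z]. *)
have -> : count_sum_from i j u = truncU Q #|inner Q i z| * X +
    (if #|inner Q i z| is k.+1 then truncU Q k else 0) * Y.
  have hz' := hu z zQ.
  have [e|uz] := eqVneq u z.
    subst u; rewrite /count_sum_from hz card_inner_next // truncU0 -/X.
    by rewrite mul1r mul0r addr0.
  have hiu : (0 < ccw i u < ccw i z)%N by ccw_lia_from i.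
  have huz : (0 < ccw u z < ccw u j)%N by clear -hiu hz n_ge3; ccw_lia_from i.
  have hin : #|inner Q i z| = #|inner Q u z|.+1.
    by rewrite (card_inner_split uQ hiu) card_inner_next.
  rewrite /count_sum_from ifT; last by clear -hiu hz; ccw_lia.
  rewrite -(eq_count_sum (c := fun Q' => 0 * (Q' == Q))%N) //.
  by rewrite (count_sum_last 0 sQ uQ zQ huz zmax nq) hin.
(* Seen from [i], [u'] is the last vertex of [Q], so it precedes [j] only if it is [z], and then the
   |Q| - 2 other vertices are inner. This term is the correction in [truncU_rec]. *)
have -> : count_sum_from i j u' = (#|inner Q i z|.+2 == #|Q|)%:R * X.
  have [e|uz] := eqVneq u' z.
    subst u'; rewrite /count_sum_from hz (card_inner_full nu') -/X.
    have -> : (#|Q| - 2).+2 = #|Q| by clear -Q3; lia.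
    by rewrite eqxx mul1r.
  have hz' := hu' z zQ.
  have hzu : (ccw i z < ccw i u')%N by ccw_lia_from i.
  have hju : (ccw i j <= ccw i u')%N by have := zmax u' u'Q; clear -hz hzu n_ge3; ccw_lia_from i.
  have hin : (#|inner Q i z| < #|inner Q i u'|)%N.
    have -> : #|inner Q i u'| = (#|inner Q i z| + 1 + #|inner Q z u'|)%N.
      by apply: card_inner_split => //; clear -hz hzu; ccw_lia.
    by rewrite addn1 addSn ltnS leq_addr.
  rewrite (card_inner_full nu') in hin.
  have -> : (#|inner Q i z|.+2 == #|Q|) = false by clear -hin Q3; lia.
  by rewrite mul0r /count_sum_from ifF //; clear -hju; ccw_lia.
have hle : (#|inner Q i z|.+2 <= #|Q|)%N.
  rewrite (cardsD1 i Q) (cardsD1 z (Q :\ i)) !inE iQ zQ eq_sym iz !add1n !ltnS.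
  apply/subset_leq_card/subsetP => v; rewrite !inE => /andP[-> hv]; rewrite andbT.
  by apply/andP; split; apply: contraTneq hv => ->; rewrite ?ltnn ?ccwxx ?andbF.
case: #|inner Q i z| hle => [|k] hle.
  rewrite !addn0 truncU1 // truncU0 truncU_rec // truncU1 // truncU0.
  by ring.
rewrite !add1n !add2n !(truncU_rec _ Q3).
(* The coefficient of [Y] has no correction, its index being below |Q|. *)
have -> : (k.+2 == #|Q|) = false by clear -hle; lia.
by move: ((k.+3 == _)%:R) => b; rewrite /=; ring.
Qed.

Lemma count_sum_rec i j : count_sum (fun=> 0%N) (i :: between i j) =
  lambda_sum i * count_sum (fun=> 0%N) (between i j) - count_sum_from i j (ordS i).
Proof.
pose edge x y : R := ((ccw x y == 1%N) || ([set x; y] \in D))%:R.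
have edgeE x y : edge x y = \sum_(Q | subgon D Q && next_in Q x y) 1.
  rewrite /edge; case: (boolP (_ || _)) => [/edge_subgon[Q0 h]|h]; first by rewrite (big_pred1 Q0).
  rewrite big_pred0 // => Q; apply/negP => /andP[sQ nQ].
  by case: (subgon_side sQ nQ) h => ->; rewrite ?orbT.
rewrite count_sum_cons.
rewrite (eq_bigr _ (fun Q h => count_sum_subgon j (andP h).1 (andP h).2)).
rewrite big_split sumrB /= -mulr_suml -addrA; congr (_ + _).
have -> : \sum_(Q | subgon D Q && (i \in Q)) \sum_(v | next_in Q i v) count_sum_from i j v =
    \sum_v edge i v * count_sum_from i j v.
  rewrite (exchange_big_dep xpredT) //=; apply: eq_bigr => v _.
  rewrite edgeE mulr_suml; apply: eq_big => [Q|Q _]; last by rewrite mul1r.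
  by rewrite -andbA; congr (_ && _); apply/andb_idl => /nextP[].
have -> : \sum_(Q | subgon D Q && (i \in Q)) \sum_(v | next_in Q v i) count_sum_from i j v =
    \sum_v edge v i * count_sum_from i j v.
  rewrite (exchange_big_dep xpredT) //=; apply: eq_bigr => v _.
  rewrite edgeE mulr_suml; apply: eq_big => [Q|Q _]; last by rewrite mul1r.
  by rewrite -andbA; congr (_ && _); apply/andb_idl => /nextP[].
have iS : ccw i (ordS i) = 1%N by apply: ccw_ordS; exact: ltnW n_ge3.
(* Diagonals count equally in both directions. The side from [i] to [ordS i] remains; the side
   arriving at [i] comes from n - 1 steps after [i], which is never strictly between [i] and [j]. *)
have -> : \sum_v edge i v * count_sum_from i j v = \sum_v edge v i * count_sum_from i j v +
    \sum_(v | v == ordS i) count_sum_from i j v; last first.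
  by rewrite big_pred1_eq; ring.
rewrite [X in _ + X]big_mkcond -big_split; apply: eq_bigr => v _ /=; rewrite /edge.
have [->|vS] := eqVneq v (ordS i).
  rewrite iS eqxx mul1r; have -> : (ccw (ordS i) i == 1%N) = false.
    by apply/eqP; clear -iS n_ge3; ccw_lia_from i.
  by case: (boolP (_ \in D)) => [/diag_ccw|_]; [ccw_lia_from i | rewrite mul0r add0r].
have -> : (ccw i v == 1%N) = false by apply/eqP => /ordS_ccw/eqP; rewrite (negPf vS).
rewrite addr0 (setUC [set i]); case: (eqVneq (ccw v i) 1%N) => // h.
by rewrite /count_sum_from ifF ?mulr0 //; have := ccw_lt i j; clear -h n_ge3; ccw_lia_from i.
Qed.

Lemma match_sum_wtL_count i j : i != j ->
  match_sum (@wtL R n) (between i j) = count_sum (fun=> 0%N) (between i j).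
Proof.
elim: {i}(ccw i j) {-2}i (leqnn (ccw i j)) => [|m IH] i hm ij.
  by move: ij; rewrite -ccw_gt0 ltnNge hm.
have one : count_sum (fun=> 0%N) [::] = 1.
  by rewrite count_sum_nil /count_wt big1 // => Q _; exact: truncU0.
have S x : ccw x (ordS x) = 1%N by apply: ccw_ordS; exact: ltnW n_ge3.
have := ij; rewrite -ccw_gt0 leq_eqVlt => /orP[/eqP e|ij2].
  by rewrite /between -e one.
rewrite (between_ordS ij2) count_sum_rec; set p := ordS i.
have hp : ((ccw p j).+1 = ccw i j)%N by have := S i; rewrite -/p; clear -ij2 n_ge3; ccw_lia_from i.
have pj : p != j by rewrite -ccw_gt0; clear -hp ij2; ccw_lia.
(* With a single vertex [p] between [i] and [j], both sums are [lambda_sum p], the second initial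
   value. *)
have := pj; rewrite -ccw_gt0 leq_eqVlt => /orP[/eqP e|pj2].
  have <- : j = ordS p by apply: ordS_ccw.
  rewrite /count_sum_from ltnn andbF /between -e one match_sum_wtL1.
  by rewrite mulr1 subr0.
rewrite -IH //; last by clear -hp hm; ccw_lia.
rewrite /count_sum_from S pj2 -(IH (ordS p)); first last.
- by rewrite -ccw_gt0; have := S p; clear -pj2 n_ge3; ccw_lia_from p.
- by have := S p; clear -hp hm pj2 n_ge3; ccw_lia_from p.
by rewrite (between_ordS pj2) match_sum_wtL_rec.
Qed.

End Dissections.

Local Open Scope ring_scope.

Theorem theorem6p14 (R : realType) (n : nat) (hn : (3 <= n)%N)
    (D : {set {set 'I_n}}) (hD : dissection D) (i j : 'I_n) (hij : i != j) :
  \sum_(w in matchings D i j) wtL R w = \sum_(w in matchings D i j) wtT R D w.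
Proof.
rewrite !big_matchings match_sum_wtL_count //.
by apply: eq_match_sum => w; rewrite wtT_count.
Qed.
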